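(* Let $S:(\mathbb{P}_m)^n\to(\mathbb{P}_m)^n$ be a map that preserves a group $H$ of permutations of $\{1,\dots,n\}$. Then, for each $i=1,\dots,n$, the invariance group $\operatorname{Stab}(S_i)$ of the component $S_i$ of $S$ is a subgroup of $H$ of index at most $n$.
   Context: $\mathbb{P}_m$ is the set of Hermitian positive definite $m\times m$ matrices and $\mathfrak{S}_n$ is the symmetric group on $\{1,\dots,n\}$. For $\underline A=(A_1,\dots,A_n)\in(\mathbb{P}_m)^n$ and $\sigma\in\mathfrak{S}_n$, write $\sigma\underline A:=(A_{\sigma(1)},\dots,A_{\sigma(n)})$. For a map $Q:(\mathbb{P}_m)^n\to\mathbb{P}_m$ put $(Q\sigma)(\underline A):=Q(\sigma\underline A)$; the invariance (or isotropy) group of $Q$ is $\operatorname{Stab}(Q):=\{\sigma\in\mathfrak{S}_n:Q=Q\sigma\}$. A map $S:(\mathbb{P}_m)^n\to(\mathbb{P}_m)^n$ preserves a subgroup $H\le\mathfrak{S}_n$ if there is a map $\tau:H\to H$ such that $S(h\underline A)=\tau(h)S(\underline A)$ for all $h\in H$ and all $\underline A\in(\mathbb{P}_m)^n$, i.e. $(S(h\underline A))_i=(S(\underline A))_{\tau(h)(i)}$ for all $i$. $S_i$ denotes the map $\underline A\mapsto(S(\underline A))_i$.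
   Formalization: Stab(S_i) is replaced by its intersection with H: Stab(S_i) taken in the full symmetric group need not lie in H (H trivial, n ≥ 2, S constant), so the claim is proved for H ∩ Stab(S_i), which equals Stab(S_i) whenever the latter lies in H. *)

(* Defs.v *)
From mathcomp Require Import all_boot all_order all_fingroup all_algebra.
From mathcomp Require Import boolp reals complex.

Set Implicit Arguments.
Unset Strict Implicit.
Unset Printing Implicit Defensive.

Import Order.TTheory GRing.Theory Num.Theory.

Local Open Scope ring_scope.
Local Open Scope sesquilinear_scope.

(* The order on [R[i]] is partial: [0 < z] says that z is real and positive. *)
Definition posdef (R : realType) (m : nat) (A : 'M[R[i]]_m) : Prop :=
  A \is hermsymmx /\
  forall x : 'cV[R[i]]_m, x != 0 -> 0 < (x^t* *m A *m x) 0 0.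

Definition Pd (R : realType) (m : nat) : Type := {A : 'M[R[i]]_m | posdef A}.

Definition permt (T : Type) (n : nat) (s : 'S_n) (A : {ffun 'I_n -> T}) :
  {ffun 'I_n -> T} := [ffun i => A (s i)].

(* The product of 'S_n composes permutations in diagrammatic order, so
   [permt (s * t) A = permt s (permt t A)].  The opposite convention has the
   same subgroups, with the same indices.
   Even if S preserves H, the stabiliser in 'S_n of a component of S need not
   be contained in H: take H trivial and S constant.  Its part in H is
   [H :&: Stab Q]. *)
Definition Stab (T : Type) (n : nat) (Q : {ffun 'I_n -> T} -> T) : {set 'S_n} :=
  [set s : 'S_n | `[< Q = (fun A => Q (permt s A)) >]].

(* Only the values of [tau] on [H] matter; it need not be a morphism. *)
Definition preserves (T : Type) (n : nat)
    (S : {ffun 'I_n -> T} -> {ffun 'I_n -> T}) (H : {group 'S_n}) : Prop :=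
  exists tau : 'S_n -> 'S_n, forall h : 'S_n, h \in H ->
    tau h \in H /\ forall A : {ffun 'I_n -> T},
      S (permt h A) = permt (tau h) (S A).

(* Main.v *)
Require Import Defs.
From mathcomp Require Import all_boot all_order all_fingroup all_algebra.
From mathcomp Require Import boolp reals complex.

(** The component S_i satisfies S_i(hA) = S(A)_{tau(h)(i)} for h in H, so two
    elements g, h of H with tau(g)(i) = tau(h)(i) satisfy S_i(gA) = S_i(hA) for
    all A and hence lie in the same coset of the stabiliser.  Therefore
    [h |-> tau(h)(i)] separates the cosets, and there are at most n of them. *)

Lemma permtM (T : Type) (n : nat) (s t : 'S_n) (A : {ffun 'I_n -> T}) :
  permt (s * t)%g A = permt s (permt t A).
Proof. by apply/ffunP => i; rewrite !ffunE permM. Qed.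

Lemma permt1 (T : Type) (n : nat) (A : {ffun 'I_n -> T}) : permt 1%g A = A.
Proof. by apply/ffunP => i; rewrite !ffunE perm1. Qed.

Lemma StabP (T : Type) (n : nat) (Q : {ffun 'I_n -> T} -> T) (s : 'S_n) :
  reflect (forall A, Q (permt s A) = Q A) (s \in Stab Q).
Proof.
rewrite inE; apply: (iffP (asboolP _)) => [eQ A | eQ].
  by rewrite [in RHS]eQ.
by apply/funext => A; rewrite eQ.
Qed.

Lemma group_set_Stab (T : Type) (n : nat) (Q : {ffun 'I_n -> T} -> T) :
  group_set (Stab Q).
Proof.
apply/group_setP; split; first by apply/StabP => A; rewrite permt1.
by move=> s t /StabP Qs /StabP Qt; apply/StabP => A; rewrite permtM Qs Qt.
Qed.

(** Taking the hypothesis at [permt t^-1 A] turns its right side into [Q A]. *)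
Lemma mem_Stab_mulV (T : Type) (n : nat) (Q : {ffun 'I_n -> T} -> T)
    (s t : 'S_n) :
  (forall A, Q (permt s A) = Q (permt t A)) -> (s * t^-1)%g \in Stab Q.
Proof.
by move=> eQ; apply/StabP => A; rewrite permtM eQ -permtM mulgV permt1.
Qed.

(** Evaluating [f] at a chosen representative of each right coset gives an injection of
    [rcosets K H] into [I]. *)
Lemma index_le_card (gT : finGroupType) (K H : {group gT}) (I : finType)
    (f : gT -> I) :
  {in H &, forall x y, f x = f y -> (x * y^-1)%g \in K} -> K \subset H ->
  #|H : K|%g <= #|I|.
Proof.
(* The representative picked by [repr] stays in [H] because [K \subset H], so [fK] applies to it. *)
move=> fK sKH; have rH C : C \in rcosets K H -> repr C \in H /\ (K :* repr C)%g = C.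
  case/rcosetsP=> x Hx ->; split; last by rewrite rcoset_repr.
  have /rcosetP[k Kk ->] := mem_repr_rcoset K x.
  by rewrite groupM // (subsetP sKH).
rewrite /indexg -(card_in_imset (f := f \o repr)) ?max_card //.
move=> C D /rH[HC defC] /rH[HD defD] /= /(fK _ _ HC HD) KCD.
by rewrite -defC -defD; apply/rcoset_eqP; rewrite mem_rcoset.
Qed.

Theorem theorem4p4 (R : realType) (m n : nat)
    (S : {ffun 'I_n -> Pd R m} -> {ffun 'I_n -> Pd R m})
    (H : {group 'S_n}) (hS : preserves S H) (i : 'I_n) :
  let K : {set 'S_n} := H :&: Stab (fun A => S A i) in
  [/\ group_set K, K \subset H & #|H : K|%g <= n].
Proof.
(* Bundling the stabiliser as a group lets [H :&: G] serve as the subgroup in [index_le_card]. *)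
move=> K; pose G := Group (group_set_Stab _ _ (fun A => S A i)).
have sKH : K \subset H by apply: subsetIl.
split=> //; first exact: group_setI H G.
have [tau tauP] := hS.
have SE h A : h \in H -> S (permt h A) i = S A (tau h i).
  by move=> /tauP[_ ->]; rewrite ffunE.
rewrite -[leqRHS]card_ord.
apply: (index_le_card _ (H :&: G)%G H _ (fun h => tau h i)) => // g h Hg Hh /= e.
rewrite inE groupM ?groupV //=; apply: mem_Stab_mulV => A.
by rewrite !SE // e.
Qed.
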